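(* Let $G$ be a finite graph and $t\ge 0$ an integer, and let $k$ be the largest clique cover width $CCW(H)$ over all $t$-shallow minors $H$ of $G$. Then $\hat\beta_t(G)\le k+1$.
   Context: All graphs are finite, simple and undirected. A $t$-shallow minor of $G$ is a graph $H$ obtained from $G$ by choosing pairwise disjoint vertex sets $V_1,\dots,V_m\subseteq V(G)$, each inducing a connected subgraph of radius at most $t$, contracting each $V_i$ to a single vertex $v_i$ and deleting all other vertices; $v_iv_j$ ($i\neq j$) is an edge of $H$ iff $G$ has an edge between $V_i$ and $V_j$. For a graph $H$, $\beta(H)$ is the minimum number of pairwise disjoint cliques partitioning $V(H)$; for $x\in V(H)$, $H_x$ is the subgraph induced by the closed neighborhood of $x$; $\tilde\beta(H)=\min_{x\in V(H)}\beta(H_x)$; and $\hat\beta_t(G)$ is the maximum of $\tilde\beta(H)$ over all $t$-shallow minors $H$ of $G$. A clique cover of $H$ is a partition $C$ of $V(H)$ into cliques; its clique cover graph is the graph obtained from $H$ by contracting each clique of $C$ into a single vertex. The clique cover width $CCW(H)$ is the minimum, over all clique covers $C$ of $H$, of the bandwidth of the clique cover graph of $C$. Equivalently, $CCW(H)$ is the minimum over ordered clique covers $(C_1,\dots,C_K)$ of $H$ of the maximum of $|j-i|$ over edges $ab$ of $H$ with $a\in C_i$, $b\in C_j$. *)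

(* Defs.v *)
From mathcomp Require Import all_boot ssrint.

Set Implicit Arguments.
Unset Strict Implicit.
Unset Printing Implicit Defensive.

(* Minimum of F over the indices satisfying P.  The value 0 when no index
   satisfies P is only a convention: below, the range of the minimum is empty
   only for the graph with no vertex. *)
Definition minval (I : finType) (P : pred I) (F : I -> nat) : nat :=
  if [pick i | P i] is Some i0 then F [arg min_(i < i0 | P i) F i] else 0.

Lemma minval_le (I : finType) (P : pred I) (F : I -> nat) (i : I) :
  P i -> minval P F <= F i.
Proof.
rewrite /minval; case: pickP => [i0 Pi0 | P0] Pi; last by rewrite P0 in Pi.
by case: arg_minnP => // j _; apply.
Qed.

Lemma minval_attained (I : finType) (P : pred I) (F : I -> nat) (i : I) :
  P i -> exists2 j, P j & minval P F = F j.
Proof.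
rewrite /minval; case: pickP => [i0 Pi0 | P0] Pi; last by rewrite P0 in Pi.
by case: arg_minnP => // j Pj _; exists j.
Qed.

Record sgraph := SGraph {
  vertex :> finType;
  adj : rel vertex;
  adj_sym : symmetric adj;
  adj_irr : irreflexive adj
}.

Section Induced.
Variables (G : sgraph) (A : {set G}).

Definition induced_adj : rel {x : G | x \in A} :=
  fun x y => adj (val x) (val y).

Lemma induced_adj_sym : symmetric induced_adj.
Proof. by move=> x y; apply: adj_sym. Qed.

Lemma induced_adj_irr : irreflexive induced_adj.
Proof. by move=> x; apply: adj_irr. Qed.

Definition induced : sgraph := SGraph induced_adj_sym induced_adj_irr.

End Induced.

(* The vertices of [contract P] are the members of P: each member is contracted
   to one vertex, and the vertices of G outside [cover P] are deleted. *)
Section Contract.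
Variables (G : sgraph) (P : {set {set G}}).

Definition contract_adj : rel {B : {set G} | B \in P} :=
  fun B B' =>
    (B != B') && [exists x in val B, exists y in val B', adj x y].

Lemma contract_adj_sym : symmetric contract_adj.
Proof.
move=> B B'; rewrite /contract_adj eq_sym; congr (_ && _).
apply/exists_inP/exists_inP => -[x xB /exists_inP [y yB xy]];
  by exists y => //; apply/exists_inP; exists x; rewrite // adj_sym.
Qed.

Lemma contract_adj_irr : irreflexive contract_adj.
Proof. by move=> B; rewrite /contract_adj eqxx. Qed.

Definition contract : sgraph := SGraph contract_adj_sym contract_adj_irr.

End Contract.

Definition connected (G : sgraph) : bool :=
  (0 < #|G|) && [forall x : G, forall y : G, connect (@adj G) x y].

(* Least length of a walk from x to y.  Shortest walks have length < #|G|, so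
   the value is #|G| exactly when y is not reachable from x. *)
Definition dist (G : sgraph) (x y : G) : nat :=
  find (fun n => [exists p : n.-tuple G, path (@adj G) x p && (last x p == y)])
       (iota 0 #|G|).

Definition radius (G : sgraph) : nat :=
  minval predT (fun x : G => \max_(y : G) dist x y).

(* P is the set {V_1, ..., V_m} of the branch sets; they are nonempty because
   [connected] excludes the empty graph. *)
Definition shallow_model (G : sgraph) (t : nat) (P : {set {set G}}) : bool :=
  trivIset P &&
  [forall B in P, connected (induced B) && (radius (induced B) <= t)].

Definition max_shallow_minor (f : sgraph -> nat) (G : sgraph) (t : nat) : nat :=
  \max_(P : {set {set G}} | shallow_model t P) f (contract P).

Definition clique (G : sgraph) (A : {set G}) : bool :=
  [forall x in A, forall y in A, (x != y) ==> adj x y].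

Definition clique_cover (G : sgraph) (C : {set {set G}}) : bool :=
  partition C [set: G] && [forall B in C, clique B].

Lemma clique_cover_singletons (G : sgraph) :
  clique_cover [set [set x] | x in [set: G]].
Proof.
apply/andP; split.
  apply/and3P; split.
  - apply/eqP/setP => x; rewrite inE; apply/bigcupP.
    by exists [set x]; rewrite ?inE // imset_f // inE.
  - apply/trivIsetP => _ _ /imsetP [x _ ->] /imsetP [y _ ->] xy.
    by rewrite disjoints1 inE; apply: contraNneq xy => ->.
  - by apply/imsetP => -[x _ /setP /(_ x)]; rewrite !inE eqxx.
apply/forall_inP => _ /imsetP [x _ ->].
apply/forall_inP => y /set1P ->; apply/forall_inP => z /set1P ->.
by rewrite eqxx.
Qed.

Definition beta (G : sgraph) : nat :=
  minval (@clique_cover G) (fun C => #|C|).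

Definition closed_nbhd (G : sgraph) (x : G) : {set G} :=
  [set y | (y == x) || adj x y].

Definition beta_tilde (G : sgraph) : nat :=
  minval predT (fun x : G => beta (induced (closed_nbhd x))).

Definition beta_hat (G : sgraph) (t : nat) : nat :=
  max_shallow_minor beta_tilde G t.

Definition bandwidth (G : sgraph) : nat :=
  minval (fun f : {ffun G -> 'I_#|G|} => injectiveb f)
    (fun f => \max_(e : G * G | adj e.1 e.2) `|f e.1 - f e.2|%N).

Definition CCW (G : sgraph) : nat :=
  minval (@clique_cover G) (fun C => bandwidth (contract C)).

(* Main.v *)
(* In any ordered clique cover of width w, take a vertex x of the first clique:
   its neighbours all lie in the first w + 1 cliques, and these restrict to a
   clique cover of the closed neighbourhood of x.  Hence
   beta_tilde H <= CCW H + 1 for every graph H, in particular for every shallow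
   minor of G. *)
Require Import Defs.
From mathcomp Require Import all_boot ssrint.

(** The cliques of [C] that meet [A] leave nonempty traces on [A], and these traces form a clique
    cover of [induced A]. *)
Lemma beta_induced_le (G : sgraph) (A : {set G}) (C : {set {set G}}) :
  clique_cover C -> beta (induced A) <= #|[set B in C | B :&: A != set0]|.
Proof.
case/andP=> /and3P [/eqP covC trivC _] /forall_inP cliqueC.
set S := [set B in C | _].
pose trace (B : {set G}) : {set induced A} := [set y | val y \in B].
apply: leq_trans (leq_imset_card trace S).
apply: (@minval_le _ _ (fun D : {set {set induced A}} => #|D|)).
apply/andP; split; first apply/and3P; first split.
- apply/eqP/setP => y; rewrite inE; apply/bigcupP.
  have : val y \in cover C by rewrite covC inE.
  case/bigcupP=> B BC yB; exists (trace B); last by rewrite inE.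
  apply: imset_f; rewrite inE BC /=; apply/set0Pn.
  by exists (val y); rewrite inE yB (valP y).
- apply/trivIsetP => _ _ /imsetP [B BS ->] /imsetP [B' BS' ->] neq.
  move: BS BS'; rewrite !inE => /andP [BC _] /andP [BC' _].
  have /(trivIsetP trivC _ _ BC BC') disjB : B != B'
    by apply: contraNneq neq => ->.
  rewrite -setI_eq0; apply/eqP/setP => y; rewrite !inE.
  by apply/andP => -[yB]; rewrite (disjointFr disjB yB).
- apply/imsetP => -[B]; rewrite inE => /andP [_ /set0Pn [y]].
  rewrite inE => /andP [yB yA] /setP /(_ (exist _ y yA)).
  by rewrite !inE yB.
apply/forall_inP => _ /imsetP [B + ->]; rewrite inE => /andP [BC _].
apply/forall_inP => y; rewrite inE => yB.
apply/forall_inP => z; rewrite inE => zB.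
apply/implyP => yz; move: (cliqueC B BC).
by move/forall_inP/(_ _ yB)/forall_inP/(_ _ zB)/implyP; apply.
Qed.

(** [enum_rank] is an injective numbering, so the minimum is over a nonempty range and some [f]
    attains it. The one-sided bound suffices for counting forward from a first vertex. *)
Lemma bandwidth_attained (G : sgraph) :
  exists2 f : G -> 'I_#|G|, injective f
    & forall x y, adj x y -> f y <= f x + bandwidth G.
Proof.
have inj0 : injectiveb [ffun x : G => enum_rank x].
  by apply/injectiveP => x y; rewrite !ffunE; apply: enum_rank_inj.
rewrite /bandwidth; set F := (F in minval _ F).
have [f /injectiveP injf ->] := minval_attained
  (P := fun f : {ffun G -> 'I_#|G|} => injectiveb f) F inj0.
exists f => // x y xy.
have : `|f y - f x|%N <= F f.
  apply: (@leq_bigmax_cond _ (fun e : G * G => adj e.1 e.2)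
            (fun e : G * G => `|f e.1 - f e.2|%N) (y, x)).
  by rewrite /= adj_sym.
case: (leqP (f y) (f x)) => [le_yx _ | lt_xy].
  exact: leq_trans le_yx (leq_addr _ _).
by rewrite distnEl ?(ltnW lt_xy) // leq_subLR.
Qed.

Lemma beta_tilde_le_CCW (G : sgraph) : beta_tilde G <= CCW G + 1.
Proof.
rewrite /beta_tilde /CCW; case: (pickP (fun _ : G => true)) => [x0 _ | G0];
  last first.
  (* On the graph with no vertex, [beta_tilde] is the default value 0. *)
  by rewrite /minval; case: pickP => // x; have := G0 x.
have [C covC ->] :=
  minval_attained (fun C => bandwidth (contract C)) (clique_cover_singletons G).
have [/and3P [/eqP covC' _ C_n0] _] := andP covC.
have block x : exists B : contract C, x \in val B.
  have : x \in cover C by rewrite covC' inE.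
  by case/bigcupP=> B BC xB; exists (exist _ B BC).
have [f injf fP] := bandwidth_attained (contract C).
(* The clique containing [x0] shows that [contract C] has a vertex; [B] is then the first clique in
   the order [f]. *)
have [B0 _] := block x0.
case: (arg_minnP (P := predT) (fun B => f B : nat) (isT : predT B0)) => B _ minB.
have [x xB] : exists x, x \in val B.
  by apply/set0Pn; apply: contraNneq C_n0 => <-; apply: valP.
apply: leq_trans (minval_le _ (isT : predT x)) _.
apply: leq_trans (beta_induced_le _ _ _ covC) _.
set S := [set _ in C | _]; set w := bandwidth _.
(* If [B'] differs from [B], it cannot contain [x] itself, by disjointness, so it contains a
   neighbour of [x] and is adjacent to [B] in [contract C]. *)
have near (B' : contract C) : val B' \in S -> f B' <= f B + w.
  rewrite inE => /andP [_ /set0Pn [y]]; rewrite !inE => /andP [yB' xy].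
  case: (eqVneq B B') => [<- | neqB]; first exact: leq_addr.
  case/orP: xy => [/eqP eyx | xy]; last first.
    apply: fP; rewrite /= /contract_adj neqB; apply/exists_inP; exists x => //.
    by apply/exists_inP; exists y.
  case/andP: covC => /and3P [_ /trivIsetP trivC _] _.
  have := trivC _ _ (valP B) (valP B') neqB.
  by move/disjointFr/(_ xB); rewrite -eyx yB'.
(* [T] is [S] seen as a set of vertices of [contract C], where [f] is defined. *)
pose T := [set B' : contract C | val B' \in S].
have <- : #|T| = #|S|.
  rewrite -(card_imset T val_inj); congr #|pred_of_set _|; apply/setP => A.
  apply/imsetP/idP => [[B'] + -> | AS]; first by rewrite in_set.
  have AC : A \in C by move: AS; rewrite inE => /andP [].
  by exists (exist _ A AC) => //; rewrite in_set.
(* The offset from the first clique lies in 0..w by [near], hence the w + 1. As [f B] is minimal,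
   the truncated subtraction loses nothing, so [g] is injective on [T]. *)
pose g B' : 'I_w.+1 := inord (f B' - f B).
rewrite addn1 -[w.+1]card_ord -(card_in_imset (f := g)) ?max_card //.
move=> B1 B2; rewrite [B1 \in T]in_set [B2 \in T]in_set.
move=> /near h1 /near h2 /(congr1 val) /=.
rewrite !inordK ?ltnS ?leq_subLR // => eq12.
apply/injf/val_inj => /=.
by rewrite -(subnK (minB B1 isT)) eq12 subnK // minB.
Qed.

Theorem theorem2 (G : sgraph) (t k : nat)
    (hk : k = max_shallow_minor CCW G t) :
  beta_hat G t <= k + 1.
Proof.
rewrite hk; apply/bigmax_leqP => P modelP.
apply: leq_trans (beta_tilde_le_CCW _) _; rewrite leq_add2r.
exact: (@leq_bigmax_cond _ (fun P : {set {set G}} => shallow_model t P)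
          (fun P : {set {set G}} => CCW (contract P)) P modelP).
Qed.
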